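(* Let $X$ be an infinite first countable Hausdorff topological space. Then $(Q(X),\tau_p)$ is completely metrizable if and only if $X$ is countable and $I(X)$ is dense in $X$.
   Context: A function $f: X\to\mathbb{R}$ is quasicontinuous at $x\in X$ if for every open $V\subset\mathbb{R}$ with $f(x)\in V$ and every open $U\subset X$ with $x\in U$ there is a nonempty open set $W\subset U$ with $f(W)\subset V$; $f$ is quasicontinuous if it is quasicontinuous at every point of $X$. $Q(X)$ is the set of all quasicontinuous functions $X\to\mathbb{R}$. $\tau_p$ is the topology of pointwise convergence, i.e. the topology on $Q(X)$ as a subspace of $\mathbb{R}^X$ with the product topology. $I(X)$ denotes the set of all isolated points of $X$. *)

(* Defs.v *)
From HB Require Import structures.
From mathcomp Require Import all_boot all_order all_algebra.
From mathcomp Require Import all_classical all_reals all_analysis.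

Set Implicit Arguments.
Unset Strict Implicit.
Unset Printing Implicit Defensive.

Import Order.TTheory GRing.Theory Num.Theory.
Import numFieldNormedType.Exports.

Local Open Scope classical_set_scope.
Local Open Scope ring_scope.

Definition first_countable (X : topologicalType) : Prop :=
  forall x : X, exists2 B : set (set X), countable B &
    (forall U, B U -> nbhs x U) /\
    (forall V, nbhs x V -> exists2 U, B U & U `<=` V).

Definition quasicontinuous_at (X Y : topologicalType) (f : X -> Y) (x : X)
  : Prop :=
  forall (V : set Y) (U : set X), open V -> V (f x) -> open U -> U x ->
    exists W : set X, [/\ open W, W !=set0, W `<=` U & f @` W `<=` V].

Definition quasicontinuous (X Y : topologicalType) (f : X -> Y) : Prop :=
  forall x : X, quasicontinuous_at f x.

(* Stated as a set in {ptws X -> R}, so that its [set_type] carries the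
   subspace topology of the product topology on R^X. *)
Definition quasicontinuous_functions (X : topologicalType) (R : realType)
  : set {ptws X -> R} :=
  [set f | quasicontinuous (f : X -> R)].
Arguments quasicontinuous_functions : clear implicits.

(* Same axioms as the library factory [isMetric]; nonnegativity follows from
   the triangle inequality. *)
Definition is_metric (R : realType) (T : Type) (d : T -> T -> R) : Prop :=
  [/\ forall x, d x x = 0,
      forall x y, d x y = 0 -> x = y,
      forall x y, d x y = d y x &
      forall y x z, d x z <= d x y + d y z].

Definition metric_induces (R : realType) (T : topologicalType)
    (d : T -> T -> R) : Prop :=
  forall (x : T) (U : set T),
    nbhs x U <-> exists2 e : R, 0 < e & [set y | d x y < e] `<=` U.

Definition metric_cauchy (R : realType) (T : Type) (d : T -> T -> R)
    (u : nat -> T) : Prop :=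
  forall e : R, 0 < e ->
    exists N : nat, forall m n : nat,
      (N <= m)%N -> (N <= n)%N -> d (u m) (u n) < e.

Definition metric_complete (R : realType) (T : Type) (d : T -> T -> R)
  : Prop :=
  forall u : nat -> T, metric_cauchy d u ->
    exists l : T, (fun n => d (u n) l) @ \oo --> (0 : R).

Definition completely_metrizable (R : realType) (T : topologicalType) : Prop :=
  exists d : T -> T -> R,
    [/\ is_metric d, metric_induces d & metric_complete d].

(* Main.v *)
Require Import Defs.
From HB Require Import structures.
From mathcomp Require Import all_boot all_order all_algebra.
From mathcomp Require Import all_classical all_reals all_analysis.
From mathcomp Require Import lra.

Import Order.TTheory GRing.Theory Num.Theory.
Import numFieldNormedType.Exports.

Local Open Scope classical_set_scope.
Local Open Scope ring_scope.

(** Topologize the real functions on [X] by pointwise convergence and let [I]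
    be the set of isolated points of [X].

    If [X] is countable and [I] is dense, quasicontinuity of [f] at [x] only
    has to be tested on isolated points: every neighbourhood [B] of [x] from a
    countable base must contain, for every [k], some [y] in [I] with
    [|f y - f x| < 1/(k+1)]
    ([quasicontinuous_isolatedP]).  For fixed [x], [B] and [k] this is an open
    condition on [f], so the quasicontinuous functions form a G-delta subset of
    a countable power of the line.  Such a set is completely metrizable by the
    trick of Alexandrov: write each open condition as [phi f > 0] with [phi]
    continuous, and add the functions [1/phi] to the evaluations as further
    coordinates, so that a Cauchy sequence cannot escape through the boundary
    [phi = 0] ([completely_metrizable_positivity]).

    Conversely, in a Hausdorff space the value of a function may be replaced by
    a constant on the closure of an open set without destroying
    quasicontinuity; hence quasicontinuous functions take arbitrary
    values on any finite set ([quasicontinuous_interpolation]).  A countable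
    neighbourhood base at one function uses only countably many points of [X],
    and by interpolation no other points can exist, so metrizability makes [X]
    countable.  If moreover some nonempty open [U] contained no isolated point,
    then the functions unbounded above on a given neighbourhood of a
    given point of [U] would be generic: interpolation prescribes a large value
    away from any given finite set.  The Baire property, applied to countably
    many such neighbourhoods, yields a quasicontinuous function unbounded above
    on every nonempty open subset of [U]; but quasicontinuity at a point of [U]
    provides a nonempty open subset of [U] on which it is bounded above. *)

(** * Metrics defined by countably many coordinates *)

Definition capped {R : realType} {I : countType} (a : I -> R) (i : I) : R :=
  Num.min (choice.pickle i).+1%:R^-1 `|a i|.

(** A Frechet-type norm for the product topology on [I -> R]: the caps tend to
    [0], so being small is a condition on finitely many coordinates.  Adding [0]
    to the set gives the supremum a meaning when [I] is empty. *)
Definition fnorm {R : realType} {I : countType} (a : I -> R) : R :=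
  sup (0 |` range (capped a)).

Lemma capped_has_ubound {R : realType} {I : countType} (a : I -> R) :
  has_ubound (0 |` range (capped a)).
Proof.
exists 1 => _ [->|[i _ <-]]; first exact: ler01.
by rewrite ge_min invf_le1 ?ltr0n// ler1n.
Qed.

Lemma capped_fnorm {R : realType} {I : countType} (a : I -> R) i :
  capped a i <= fnorm a.
Proof.
by apply: ub_le_sup; [exact: capped_has_ubound|right; exists i].
Qed.

Lemma fnorm_le {R : realType} {I : countType} (a : I -> R) (e : R) :
  0 <= e -> (forall i, capped a i <= e) -> fnorm a <= e.
Proof.
move=> e0 ae; apply: ge_sup; first by exists 0; left.
by move=> _ [->//|[i _ <-]].
Qed.

Lemma fnorm_ge0 {R : realType} {I : countType} (a : I -> R) : 0 <= fnorm a.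
Proof.
by apply: ub_le_sup; [exact: capped_has_ubound|left].
Qed.

(** As long as the norm stays below the cap of the coordinate [i], the cap is
    inactive and the norm controls [|a i|] itself. *)
Lemma capped_lt {R : realType} {I : countType} (a : I -> R) i (e : R) :
  capped a i < Num.min e (choice.pickle i).+1%:R^-1 -> `|a i| < e.
Proof.
rewrite lt_min /capped !gt_min ltxx orFb => /andP[/orP[we|//] aw].
exact: lt_trans aw we.
Qed.

Lemma eq_fnorm {R : realType} {I : countType} (a b : I -> R) :
  (forall i, `|a i| = `|b i|) -> fnorm a = fnorm b.
Proof.
move=> ab; rewrite /fnorm; suff -> : capped a = capped b by [].
by apply/funext => i; rewrite /capped ab.
Qed.

Lemma fnorm_eq0 {R : realType} {I : countType} (a : I -> R) :
  fnorm a = 0 <-> forall i, a i = 0.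
Proof.
split=> [a0 i|a0].
  have := capped_fnorm a i; rewrite a0 /capped ge_min normr_le0.
  by rewrite leNgt invr_gt0 ltr0n/= => /eqP.
apply/eqP; rewrite eq_le fnorm_ge0 andbT; apply: fnorm_le => // i.
by rewrite /capped a0 normr0 ge_min lexx orbT.
Qed.

Lemma fnorm_le_sum {R : realType} {I : countType} (a b c : I -> R) :
  (forall i, `|a i| <= `|b i| + `|c i|) -> fnorm a <= fnorm b + fnorm c.
Proof.
move=> abc; apply: fnorm_le => [|i]; first by rewrite addr_ge0 ?fnorm_ge0.
apply: le_trans (lerD (capped_fnorm b i) (capped_fnorm c i)).
have := abc i; rewrite /capped.
have : 0 < (choice.pickle i).+1%:R^-1 :> R by rewrite invr_gt0 ltr0n.
move: (normr_ge0 (a i)) (normr_ge0 (b i)) (normr_ge0 (c i)).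
move: (`|a i|) (`|b i|) (`|c i|) (_^-1) => x y z w x0 y0 z0 w0 xyz.
by rewrite /Num.min; case: (ltP w x); case: (ltP w y); case: (ltP w z); lra.
Qed.

Lemma near_forall_pickle {I : countType} {S : Type} (F : set_system S)
    (P : I -> set S) : Filter F -> (forall i, F (P i)) ->
  forall N : nat, \forall s \near F, forall i, (choice.pickle i < N)%N -> P i s.
Proof.
move=> FF FP; elim=> [|N IH]; first exact: nearW.
have FN : \forall s \near F, forall i, choice.pickle i = N -> P i s.
  have [[i <-]|nN] := pselect (exists i : I, choice.pickle i = N).
    by apply: filterS (FP i) => s Ps j /(pcan_inj choice.pickleK) ->.
  by apply: nearW => s i iN; case: nN; exists i.
apply: filterS2 IH FN => s h1 h2 i; rewrite ltnS leq_eqVlt => /orP[/eqP|].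
  exact: h2.
exact: h1.
Qed.

(** Convergence in norm is coordinatewise convergence: below [e], only the
    finitely many coordinates whose cap exceeds [e / 2] matter. *)
Lemma fnorm_cvg0 {R : realType} {I : countType} {S : Type} (F : set_system S)
    (a : S -> I -> R) : Filter F ->
  (fnorm (a s) @[s --> F] --> 0) <-> (forall i, a s i @[s --> F] --> 0).
Proof.
move=> FF; split=> [/cvgr0Pnorm_lt a0 i|a0]; apply/cvgr0Pnorm_lt => e e0.
  have m0 : 0 < Num.min e (choice.pickle i).+1%:R^-1.
    by rewrite lt_min e0 invr_gt0 ltr0n.
  apply: filterS (a0 _ m0) => s; rewrite ger0_norm ?fnorm_ge0// => h.
  by apply: capped_lt; apply: le_lt_trans h; exact: capped_fnorm.
have e20 : 0 < e / 2 by rewrite divr_gt0.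
have [N _ hN] := near_infty_natSinv_lt (PosNum e20).
have aN i : F (fun s => `|a s i| < e / 2).
  by move/cvgr0Pnorm_lt : (a0 i); exact.
apply: filterS (near_forall_pickle F _ FF aN N) => s hs.
rewrite ger0_norm ?fnorm_ge0//; apply: (@le_lt_trans _ _ (e / 2)); last first.
  by rewrite ltr_pdivrMr// ltr_pMr// ltr1n.
apply: fnorm_le => [|i]; first exact: ltW.
rewrite /capped ge_min; apply/orP; have [iN|Ni] := ltnP (choice.pickle i) N.
  by right; apply/ltW/hs.
by left; apply/ltW/hN.
Qed.

Lemma fnorm_cvg {R : realType} {I : countType} {S : Type} (F : set_system S)
    (a : S -> I -> R) (b : I -> R) : Filter F ->
  (forall i, a s i @[s --> F] --> b i) -> fnorm (a s) @[s --> F] --> fnorm b.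
Proof.
move=> FF ab; have /(fnorm_cvg0 F (fun s i => b i - a s i)) :
    forall i, b i - a s i @[s --> F] --> 0.
  move=> i; rewrite -(subrr (b i)).
  by apply: cvgB; [exact: cvg_cst|exact: ab].
move=> /cvgr0Pnorm_lt h; apply/cvgrPdist_lt => e /h; apply: filterS => s.
rewrite ger0_norm ?fnorm_ge0//; apply: le_lt_trans.
have h1 : fnorm b <= fnorm (fun i => b i - a s i) + fnorm (a s).
  apply: fnorm_le_sum => i.
  by rewrite -[in leLHS](subrK (a s i) (b i)) ler_normD.
have h2 : fnorm (a s) <= fnorm (fun i => b i - a s i) + fnorm b.
  apply: fnorm_le_sum => i.
  by rewrite (distrC (b i)) -[in leLHS](subrK (b i) (a s i)) ler_normD.
by rewrite ler_distl; apply/andP; split; lra.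
Qed.

(** The metric is the [fnorm] of the difference of the coordinates.  Cauchy
    sequences for it are Cauchy in each coordinate, so the last hypothesis,
    saying that the coordinates embed [T] as a closed subset of [I -> R], is
    what completeness amounts to. *)
Lemma completely_metrizable_coordinates {R : realType} {T : topologicalType}
    {I : countType} (h : I -> T -> R) :
  (forall (F : set_system T) (x : T), Filter F ->
    F --> x <-> forall i, h i y @[y --> F] --> h i x) ->
  (forall x y, (forall i, h i x = h i y) -> x = y) ->
  (forall u : nat -> T, (forall i, cvgn (fun n => h i (u n))) ->
    exists l, forall i, h i (u n) @[n --> \oo] --> h i l) ->
  completely_metrizable R T.
Proof.
move=> hcvg hinj hcomplete.
pose d x y : R := fnorm (fun i => h i x - h i y).
have dC x y : d x y = d y x by apply: eq_fnorm => i; rewrite distrC.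
have cvgd0 (S : Type) (F : set_system S) (u : S -> T) (x : T) : Filter F ->
    (d (u s) x @[s --> F] --> 0) <->
    (forall i, h i (u s) @[s --> F] --> h i x).
  move=> FF; rewrite /d (fnorm_cvg0 F (fun s i => h i (u s) - h i x)).
  by split=> hF i; apply/subr_cvg0; exact: hF.
exists d; split.
- split=> [x|x y d0|//|y x z].
  + by apply/fnorm_eq0 => i; rewrite subrr.
  + apply: hinj => i; apply/eqP; rewrite -subr_eq0; apply/eqP.
    by move/fnorm_eq0 : d0; apply.
  + apply: fnorm_le_sum => i.
    by rewrite (le_trans _ (ler_normD _ _))// addrA subrK.
- move=> x U; split=> [xU|[e e0 eU]].
    pose B := filter_from [set e : R | 0 < e] (fun e => [set y | d x y < e]).
    have FB : Filter B.
      apply: filter_from_filter; first by exists 1 => /=.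
      move=> e1 e2 e10 e20; exists (Num.min e1 e2) => /=.
        by rewrite lt_min e10.
      by move=> y /=; rewrite lt_min => /andP[].
    suff : B --> x by move/(_ _ xU).
    apply/hcvg/(cvgd0 T B id x) => //.
    apply/cvgr0Pnorm_lt => e e0; exists e => //.
    by move=> y /=; rewrite dC ger0_norm ?fnorm_ge0.
  have : d y x @[y --> x] --> 0.
    apply/(cvgd0 T (nbhs x) id x).
    by apply/(hcvg (nbhs x) x); exact: cvg_id.
  move/cvgr0Pnorm_lt/(_ _ e0); apply: filterS => y.
  by rewrite ger0_norm ?fnorm_ge0// dC => /eU.
- move=> u cu; have [i|l ul] := hcomplete u.
    apply: R_complete; apply: cauchy_exP => e e0.
    have m0 : 0 < Num.min e (choice.pickle i).+1%:R^-1.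
      by rewrite lt_min e0 invr_gt0 ltr0n.
    have [N hN] := cu _ m0; exists (h i (u N)).
    exists N => // n /= Nn; rewrite /ball /=.
    apply: (capped_lt (fun i => h i (u N) - h i (u n))).
    apply: le_lt_trans (hN _ _ (leqnn N) Nn).
    exact: (capped_fnorm (fun i => h i (u N) - h i (u n))).
  by exists l; apply/(cvgd0 nat \oo u l).
Qed.

(** * G-delta sets of functions *)

Lemma subtype_cvgP {X : topologicalType} {A : set X}
    (F : set_system (set_type A)) (x : set_type A) : Filter F ->
  F --> x <-> val y @[y --> F] --> val x.
Proof.
move=> FF; split=> [Fx U xU|Fx U [_ [[V oV <-] Vx VU]]].
  by apply: Fx; exact: (@initial_continuous (set_type A) X set_val x U xU).
apply: filterS VU _; apply: Fx; exact: open_nbhs_nbhs.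
Qed.

Lemma ptws_subtype_cvgP {R : realType} {X : topologicalType}
    {P : set {ptws X -> R}} (F : set_system (set_type P)) (f : set_type P) :
  Filter F ->
  F --> f <-> forall x, (val g : X -> R) x @[g --> F] --> (val f : X -> R) x.
Proof.
move=> FF; rewrite subtype_cvgP.
exact: (@pointwise_cvgP X R (val @ F) (val f : X -> R) _).
Qed.

Lemma range_countable {T : Type} (A : set T) :
  A !=set0 -> countable A -> exists p : nat -> T, A = range p.
Proof.
move=> [a Aa] /countable_injP[f finj].
have /choice[p hp] : forall n,
    exists x, A x /\ forall y, A y -> f y = n -> x = y.
  move=> n; have [[y [Ay fy]]|none] := pselect (exists y, A y /\ f y = n).
    exists y; split=> // z Az fz; apply: finj; rewrite ?inE//.
    by rewrite fy fz.
  by exists a; split=> // y Ay fy; case: none; exists y.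
exists p; apply/seteqP; split=> [x Ax|_ [n _ <-]]; last by case: (hp n).
by exists (f x) => //; case: (hp (f x)) => _; exact.
Qed.

(** Alexandrov's theorem for sets of the form [phi j > 0] for all [j].  The
    coordinates are the evaluations at the points of [X] together with the
    inverses of the [phi j].  If all of them converge along a sequence in [P],
    the pointwise limit [l] is in [P]: were [phi j l = 0], the product of
    [phi j] with its inverse, which is constantly [1], would tend to [0]. *)
Lemma completely_metrizable_positivity {R : realType} {X : topologicalType}
    {J : countType} (p : nat -> X) (phi : J -> {ptws X -> R} -> R)
    (P : set {ptws X -> R}) :
  [set: X] = range p ->
  (forall j, continuous (phi j)) ->
  (forall f, P f <-> forall j, 0 < phi j f) ->
  completely_metrizable R (set_type P).
Proof.
move=> pX cphi Pphi.
have surjp x : exists n, p n = x.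
  by have : [set: X] x by []; rewrite pX => -[n _ <-]; exists n.
have phi0 (f : set_type P) j : phi j (val f) != 0.
  by have /Pphi/(_ j)/lt0r_neq0 := set_valP f.
pose h (i : nat + J) (f : set_type P) : R :=
  match i with inl n => (val f : X -> R) (p n) | inr j => (phi j (val f))^-1 end.
apply: (completely_metrizable_coordinates h) => [F f FF|f g fg|u hu].
- split=> [Ff [n|j]|Ff].
  + by move/ptws_subtype_cvgP : Ff; exact.
  + apply: cvgV => //; move/subtype_cvgP : Ff => Ff.
    exact: (cvg_comp (fun g : set_type P => val g) (phi j) Ff (cphi j (val f))).
  + by apply/ptws_subtype_cvgP => x; have [n <-] := surjp x; exact: (Ff (inl n)).
- apply: val_inj; apply/funext => x; have [n <-] := surjp x; exact: (fg (inl n)).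
- pose l : {ptws X -> R} := fun x => lim ((val (u n) : X -> R) x @[n --> \oo]).
  have ul : val (u n) @[n --> \oo] --> l.
    apply/(@pointwise_cvgP X R ((fun n => val (u n)) @ \oo) l _) => x.
    have [n <-] := surjp x; exact: (hu (inl n)).
  have Pl : P l.
    apply/Pphi => j.
    have ulj := cvg_comp (fun n => val (u n)) (phi j) ul (cphi j l).
    have phiul n : 0 < phi j (val (u n)) by have /Pphi := set_valP (u n); exact.
    have ge0 : 0 <= phi j l.
      by apply: (cvgr_to_ge ulj); apply: nearW => n; exact/ltW/phiul.
    rewrite lt0r ge0 andbT; apply/eqP => phil0.
    have hphi : h (inr j) (u n) * phi j (val (u n)) @[n --> \oo] --> (0 : R).
      rewrite -(mulr0 (limn (fun n => h (inr j) (u n)))) -phil0.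
      exact: cvgM (hu (inr j)) ulj.
    have h1 n : h (inr j) (u n) * phi j (val (u n)) = 1.
      by rewrite mulVf ?gt_eqF.
    move: hphi; under eq_fun do rewrite h1.
    move=> /(cvg_unique (@norm_hausdorff _ R^o) (cvg_cst (1 : R))).
    by move/eqP; rewrite oner_eq0.
  exists (SigSub (mem_set Pl)) => -[n|j] /=; first exact: (hu (inl n)).
  apply: cvgV; first exact: (phi0 (SigSub (mem_set Pl))).
  exact: (cvg_comp (fun n => val (u n)) (phi j) ul (cphi j l)).
Qed.

(** * Quasicontinuity when the isolated points are dense *)

Lemma first_countable_base {X : topologicalType} : first_countable X ->
  exists B : X -> nat -> set X, forall x,
    (forall n, nbhs x (B x n)) /\
    (forall V, nbhs x V -> exists n, B x n `<=` V).
Proof.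
move=> fcX; suff /choice[B hB] : forall x : X, exists b : nat -> set X,
    (forall n, nbhs x (b n)) /\ (forall V, nbhs x V -> exists n, b n `<=` V).
  by exists B.
move=> x; have [S cS [Sx hS]] := fcX x.
have S0 : S !=set0 by have [U SU _] := hS _ (@filterT _ (nbhs x) _); exists U.
have [b Sb] := range_countable S S0 cS.
exists b; split=> [n|V /hS[U SU UV]]; first by apply: Sx; rewrite Sb; exists n.
by move: SU UV; rewrite Sb => -[n _ <-]; exists n.
Qed.

Lemma isolatedTP {X : topologicalType} (x : X) :
  isolated [set: X] x <-> nbhs x [set x].
Proof.
split=> [[_ [V xV]]|xx]; first by rewrite setIT => <-.
by split; [rewrite inE|exists [set x] => //; rewrite setIT].
Qed.

(** Density puts an isolated point [y] in the open set given by
    quasicontinuity; conversely the singleton of [y] is itself an admissible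
    open set.  This removes the quantification over open sets that would make
    the condition fail to be a countable intersection of open ones. *)
Lemma quasicontinuous_isolatedP {R : realType} {X : topologicalType}
    (B : X -> nat -> set X) (f : X -> R) :
  dense (isolated [set: X]) ->
  (forall x, (forall n, nbhs x (B x n)) /\
    (forall V, nbhs x V -> exists n, B x n `<=` V)) ->
  quasicontinuous f <->
  forall x n k, exists y,
    [/\ isolated [set: X] y, B x n y & `|f y - f x| < k.+1%:R^-1].
Proof.
move=> dI hB; split=> [qf x n k|hf x V U oV Vfx oU Ux].
  have k0 : 0 < k.+1%:R^-1 :> R by rewrite invr_gt0.
  have := nbhsx_ballx (f x) _ k0.
  have /(_ n) := (hB x).1; rewrite !nbhsE => -[U [oU Ux] UB] [V [oV Vfx] Vk].
  have [W [oW W0 WU fWV]] := qf x V U oV Vfx oU Ux.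
  have [y [Wy Iy]] := dI W W0 oW; exists y; split=> //; first exact/UB/WU.
  by have /Vk := fWV _ (ex_intro2 _ _ _ Wy erefl); rewrite /ball /= distrC.
have [n BU] := (hB x).2 _ (open_nbhs_nbhs (conj oU Ux)).
have /nbhs_ballP[e e0 eV] := open_nbhs_nbhs (conj oV Vfx).
have [k _ /(_ k (leqnn k)) ke] := near_infty_natSinv_lt (PosNum e0).
have [y [Iy By fyx]] := hf x n k; exists [set y]; split.
- by rewrite openE => _ ->; apply/isolatedTP.
- by exists y.
- by move=> _ ->; exact: BU.
- move=> _ [_ -> <-]; apply: eV; rewrite /ball /= distrC.
  exact: lt_trans fyx ke.
Qed.

(** The condition indexed by [j = (m, n, k)], that some isolated [y] in the
    [n]-th neighbourhood of [x = p m] has [t := 1/(k+1) - |f y - f x| > 0], is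
    turned into the positivity of one continuous function of [f] by taking the
    [fnorm] over all [y] of [t + |t|], which is nonzero exactly when
    [t > 0]. *)
Lemma completely_metrizable_quasicontinuous {R : realType}
    {X : topologicalType} :
  [set: X] !=set0 -> first_countable X -> countable [set: X] ->
  dense (isolated [set: X]) ->
  completely_metrizable R (set_type (quasicontinuous_functions X R)).
Proof.
move=> X0 /first_countable_base[B hB] cX dI.
have [p pX] := range_countable _ X0 cX.
have surjp x : exists n, p n = x.
  by have : [set: X] x by []; rewrite pX => -[n _ <-]; exists n.
pose D (j : nat * nat * nat) := isolated [set: X] `&` B (p j.1.1) j.1.2.
pose gap (j : nat * nat * nat) (f : X -> R) (i : nat) : R :=
  if `[< D j (p i) >]
  then let t := j.2.+1%:R^-1 - `|f (p i) - f (p j.1.1)| in t + `|t| else 0.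
apply: (completely_metrizable_positivity p (fun j f => fnorm (gap j f))) => //.
  move=> j f; pose F := nbhs (f : {ptws X -> R}).
  have FF : Filter F by exact: nbhs_filter.
  apply: (fnorm_cvg F (gap j)) => i; rewrite /gap.
  have ev x : (g : X -> R) x @[g --> F] --> (f : X -> R) x.
    by move: x; apply/(@pointwise_cvgP X R F f); exact: cvg_id.
  case: asboolP => _; last exact: cvg_cst.
  have cvgt : j.2.+1%:R^-1 - `|(g : X -> R) (p i) - (g : X -> R) (p j.1.1)|
      @[g --> F]
      --> j.2.+1%:R^-1 - `|(f : X -> R) (p i) - (f : X -> R) (p j.1.1)|.
    exact: (cvgB (cvg_cst _) (cvg_norm (cvgB (ev (p i)) (ev (p j.1.1))))).
  exact: (cvgD cvgt (cvg_norm cvgt)).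
move=> f; rewrite /quasicontinuous_functions /=.
rewrite (quasicontinuous_isolatedP B f dI hB); split=> [hf [[m n] k]|hf x n k].
  have [y [Iy By fy]] := hf (p m) n k; have [i yi] := surjp y.
  rewrite lt0r fnorm_ge0 andbT; apply/eqP => /fnorm_eq0/(_ i)/eqP.
  rewrite /gap yi; case: asboolP => [_|[]]; last by split.
  by rewrite gt_eqF// ltr_wpDr// subr_gt0.
have [m <-] := surjp x.
have := hf (m, n, k); rewrite lt0r fnorm_ge0 andbT => /eqP gap0.
have [i gi] : exists i, gap (m, n, k) f i <> 0.
  by apply/not_existsP => h; apply/gap0/fnorm_eq0 => i; apply: contrapT; exact: h.
exists (p i); move: gi; rewrite /gap; case: asboolP => //= -[Ip Bp] gi.
split=> //; rewrite -subr_gt0 ltNge; apply/negP => le0.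
by apply: gi; rewrite /= (ler0_norm le0) subrr.
Qed.

(** * Interpolation by quasicontinuous functions *)

Lemma separate_seq {X : topologicalType} (x : X) (s : seq X) :
  hausdorff_space X -> x \notin s ->
  exists U : set X, [/\ open U, U x & forall z, z \in s -> ~ closure U z].
Proof.
rewrite open_hausdorff => hX; elim: s => [|z s IH].
  by exists setT; split=> //; exact: openT.
rewrite inE negb_or => /andP[xz /IH[U [oU Ux Us]]].
have [[A B] /= [/set_mem Ax /set_mem Bz] [oA oB /eqP AB]] := hX x z xz.
exists (U `&` A); split=> //; first exact: openI.
move=> y; rewrite inE => /orP[/eqP ->|/Us Uy cy].
  move=> /(_ B (open_nbhs_nbhs (conj oB Bz)))[w [[_ Aw] Bw]].
  by have : (A `&` B) w by []; rewrite AB.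
by apply: Uy; apply: closureS cy => w [].
Qed.

(** Every neighbourhood of a point of [closure U] meets the open set [U], where
    the new function is already constant; off [closure U], which is closed, the
    function is locally unchanged. *)
Lemma quasicontinuous_patch {X Y : topologicalType} (U : set X) (c : Y)
    (f : X -> Y) : open U -> quasicontinuous f ->
  quasicontinuous (fun x => if `[< closure U x >] then c else f x).
Proof.
move=> oU qf x V W oV; case: asboolP => [cx|ncx] Vy oW Wx.
  have [w [Uw Ww]] := cx W (open_nbhs_nbhs (conj oW Wx)).
  exists (U `&` W); split=> [||z []//|_ [z [Uz _] <-]]; first exact: openI.
    by exists w.
  by case: asboolP => // -[]; exact: subset_closure.
have oC : open (~` closure U) by exact/closed_openC/closed_closure.
have [W' [oW' W'0 W'W fW'V]] := qf x V (W `&` ~` closure U) oV Vy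
  (openI oW oC) (conj Wx ncx).
exists W'; split=> // [z /W'W[]//|_ [z W'z <-]].
case: asboolP => [|_]; first by case: (W'W _ W'z).
by apply: fW'V; exists z.
Qed.

(** One point is added at a time, by patching on the closure of a
    neighbourhood of the new point which avoids the points already treated. *)
Lemma quasicontinuous_interpolation {X Y : topologicalType} (s : seq X)
    (v : X -> Y) : hausdorff_space X ->
  exists f : X -> Y, quasicontinuous f /\ forall x, x \in s -> f x = v x.
Proof.
move=> hX; elim: s => [|x s [f [qf fs]]].
  have [x0|nX] := pselect (exists x : X, True); last first.
    by exists v; split=> // x; case: nX; exists x.
  case: x0 => x0 _; exists (fun=> v x0); split=> // x V U oV Vx oU Ux.
  by exists U; split=> // [|_ [z _ <-]//]; exists x.
have [xs|/(separate_seq x s hX)[U [oU Ux Us]]] := boolP (x \in s).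
  by exists f; split=> // y; rewrite inE => /orP[/eqP->|]; exact: fs.
exists (fun y => if `[< closure U y >] then v x else f y).
split; first exact: quasicontinuous_patch.
move=> y; rewrite inE => /orP[/eqP->|ys].
  by case: asboolP => // -[]; exact: subset_closure.
by case: asboolP => [/(Us _ ys)//|_]; exact: fs.
Qed.

(** The sets of functions [e]-close to [f] on a finite [s] generate a filter
    which converges pointwise to [f], hence is finer than the neighbourhood
    filter of [f]. *)
Lemma nbhs_ptws_subtypeP {R : realType} {X : topologicalType}
    {P : set {ptws X -> R}} (f : set_type P) (U : set (set_type P)) :
  nbhs f U -> exists (s : seq X) (e : R), 0 < e /\
    forall g : set_type P, (forall x, x \in s ->
      `|(val g : X -> R) x - (val f : X -> R) x| < e) -> U g.
Proof.
pose box (se : seq X * R) : set (set_type P) :=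
  [set g | forall x, x \in se.1 ->
    `|(val g : X -> R) x - (val f : X -> R) x| < se.2].
pose F := filter_from [set se : seq X * R | 0 < se.2] box.
have FF : Filter F.
  apply: filter_from_filter; first by exists ([::], 1) => /=.
  move=> [s1 e1] [s2 e2] /= e10 e20; exists (s1 ++ s2, Num.min e1 e2) => /=.
    by rewrite lt_min e10.
  move=> g /= hg; split=> x /= xs; have := hg x.
    by rewrite mem_cat xs lt_min => /(_ isT)/andP[].
  by rewrite mem_cat xs orbT lt_min => /(_ isT)/andP[].
suff Ff : F --> f by move=> /Ff[[s e] /= e0 sU]; exists s, e; split.
apply/ptws_subtype_cvgP => x; apply/cvgrPdist_lt => e e0.
by exists ([:: x], e) => //= g /(_ x); rewrite inE eqxx distrC; exact.
Qed.

(** * The Baire property *)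

(** The usual nested balls.  The [n.+1]-st ball, even with its radius doubled,
    lies in [O n] and in the [n]-th ball; the doubling keeps the limit of
    the centres, which is only in the closure of each ball, inside [O n]. *)
Lemma metrizable_Baire {R : realType} {T : topologicalType} (d : T -> T -> R)
    (O : nat -> set T) (x0 : T) :
  is_metric d -> metric_induces d -> metric_complete d ->
  (forall n, open (O n)) -> (forall n, dense (O n)) ->
  exists x, forall n, O n x.
Proof.
move=> [d0 _ dC dT] dnbhs dcomplete oO dO.
have ball_open (x : T) (r : R) : open [set y | d x y < r].
  rewrite openE => y /= xyr; apply/dnbhs; exists (r - d x y).
    by rewrite subr_gt0.
  by move=> z /= yz; apply: le_lt_trans (dT y x z) _; lra.
pose step n (p q : T * R) := 0 < p.2 ->
  [/\ 0 < q.2, q.2 <= p.2 / 2, d p.1 q.1 < p.2 &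
      forall z, d q.1 z < 2 * q.2 -> O n z /\ d p.1 z < p.2].
have /choice[next hnext] : forall np : nat * (T * R), exists q, step np.1 np.2 q.
  move=> [n [x r]]; have [r0|nr] := pselect (0 < r); last by exists (x, r).
  have [y [/= xy Oy]] : [set y | d x y < r] `&` O n !=set0.
    by apply: dO; [exists x => /=; rewrite d0|exact: ball_open].
  have /dnbhs[e e0 he] : nbhs y ([set y | d x y < r] `&` O n).
    by apply: open_nbhs_nbhs; split=> //; apply: openI.
  (* [r / 2] makes the radii tend to 0, [e / 2] leaves room for doubling. *)
  exists (y, Num.min (r / 2) (e / 2)) => _ /=; split=> //.
  - by rewrite lt_min !divr_gt0.
  - by rewrite ge_min lexx.
  - move=> z yz; have [] // := he z; apply: lt_le_trans yz _.
    have : Num.min (r / 2) (e / 2) <= e / 2 by rewrite ge_min lexx orbT.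
    lra.
pose p := fix p n := if n is m.+1 then next (m, p m) else (x0, 1 : R).
have p0 n : 0 < (p n).2.
  by elim: n => [|n IH] /=; [exact: ltr01|case: (hnext (n, p n) IH)].
have pS n : step n (p n) (p n.+1) by exact: (hnext (n, p n)).
have rn n : (p n).2 <= n.+1%:R^-1.
  elim: n => [|n IH]; first by rewrite invr1.
  have [_ h _ _] := pS n (p0 n); apply: le_trans h _.
  apply: (@le_trans _ _ (n.+1%:R^-1 / 2)); first by rewrite ler_wpM2r.
  rewrite -invfM -natrM lef_pV2 ?posrE ?ltr0n// ler_nat muln2 -addnn.
  by rewrite addSn addnS !ltnS leq_addr.
have nest m n : (m <= n)%N -> forall z, d (p n).1 z < (p n).2 ->
    d (p m).1 z < (p m).2.
  move=> /subnK <-; elim: (n - m)%N => [//|k IH] z hz; apply: IH.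
  have [q0 _ _ hq] := pS (k + m)%N (p0 _).
  have [] // := hq z; apply: lt_trans hz _; move: q0 => /=; lra.
have near m n : (m <= n)%N -> d (p m).1 (p n).1 < (p m).2.
  by move=> mn; apply: nest mn _ _; rewrite d0.
have [|l ul] := dcomplete (fun n => (p n).1).
  move=> e e0; have e20 : 0 < e / 2 by rewrite divr_gt0.
  have [N _ hN] := near_infty_natSinv_lt (PosNum e20).
  exists N => m n Nm Nn; have rN : (p N).2 < e / 2.
    exact: le_lt_trans (rn N) (hN N (leqnn N)).
  apply: le_lt_trans (dT (p N).1 _ _) _; rewrite (splitr e) ltrD//.
    by rewrite dC; exact: lt_trans (near N m Nm) rN.
  exact: lt_trans (near N n Nn) rN.
exists l => n; have [q0 _ _ hq] := pS n (p0 n).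
apply: (hq l _).1.
have /cvgr0Pnorm_lt/(_ _ q0)[N _ hN] := ul.
have := hN (maxn N n.+1) (leq_maxl _ _).
have := near n.+1 (maxn N n.+1) (leq_maxr _ _).
have := dT (p (maxn N n.+1)).1 (p n.+1).1 l.
move: (ler_norm (d (p (maxn N n.+1)).1 l)); lra.
Qed.

Lemma quasicontinuous_functions_interpolation {X : topologicalType} :
  hausdorff_space X -> forall (R : realType) (s : seq X) (v : X -> R),
  exists f : set_type (quasicontinuous_functions X R),
    forall x, x \in s -> (val f : X -> R) x = v x.
Proof.
move=> hX R s v; have [f [qf fs]] := quasicontinuous_interpolation s v hX.
by exists (SigSub (mem_set (qf : quasicontinuous_functions X R f))).
Qed.

(** * Consequences of metrizability *)

(** The [n]-th ball around [f0] contains all functions that agree with [f0] on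
    some finite set [s n].  The sets [s n] exhaust [X]: otherwise, for [x]
    outside of them, each ball would contain a function whose value at [x] is
    [f0 x + 1], although evaluation at [x] is continuous. *)
Lemma countable_metrizable_quasicontinuous {R : realType} {X : topologicalType}
    (d : set_type (quasicontinuous_functions X R) ->
      set_type (quasicontinuous_functions X R) -> R) :
  hausdorff_space X -> metric_induces d -> countable [set: X].
Proof.
move=> hX dnbhs.
have interp := quasicontinuous_functions_interpolation hX.
have [f0 _] := interp R [::] (cst 0).
have /choice[s hs] : forall n : nat, exists s : seq X,
    forall g, (forall x, x \in s -> (val g : X -> R) x = (val f0 : X -> R) x) ->
      d f0 g < n.+1%:R^-1.
  move=> n; have : nbhs f0 [set g | d f0 g < n.+1%:R^-1].
    by apply/dnbhs; exists n.+1%:R^-1 => //; rewrite invr_gt0.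
  move=> /nbhs_ptws_subtypeP[s [e [e0 hs]]]; exists s => g gf; apply: hs => x xs.
  by rewrite gf// subrr normr0.
suff -> : [set: X] = \bigcup_n [set` s n].
  by apply: bigcup_countable => // n _; exact/finite_set_countable/finite_seq.
apply/seteqP; split=> // x _.
have : nbhs f0 [set g | `|(val f0 : X -> R) x - (val g : X -> R) x| < 1].
  have /ptws_subtype_cvgP/(_ x)/cvgrPdist_lt : nbhs f0 --> f0 by exact: cvg_id.
  by apply; exact: ltr01.
move=> /dnbhs[e e0 he].
have [n _ /(_ n (leqnn n)) ne] := near_infty_natSinv_lt (PosNum e0).
exists n => //=; apply: contrapT => /negP xs.
have [g hg] := interp R (x :: s n)
  (fun y => if y == x then (val f0 : X -> R) x + 1 else (val f0 : X -> R) y).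
have /he /= : d f0 g < e.
  apply: lt_trans ne; apply: hs => y ys; rewrite hg ?inE ?ys ?orbT//.
  by case: eqP => // yx; rewrite -yx ys in xs.
by rewrite hg ?inE ?eqxx// opprD addNKr normrN normr1 ltxx.
Qed.

(** A neighbourhood of [x] avoiding the points of [s] other than [x] is not
    reduced to [x] when [x] is not isolated. *)
Lemma nonisolated_notin {X : topologicalType} (x : X) (A : set X) (s : seq X) :
  hausdorff_space X -> ~ isolated [set: X] x -> nbhs x A ->
  exists2 w, A w & w \notin s.
Proof.
move=> hX nx xA.
have [|U [oU Ux Us]] := separate_seq x [seq z <- s | z != x] hX.
  by rewrite mem_filter eqxx.
have [//|] := pselect (exists2 w, A w & w \notin s).
move=> none; case: nx; apply/isolatedTP.
apply: filterS2 xA (open_nbhs_nbhs (conj oU Ux)) => w Aw Uw /=.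
apply: contrapT => /eqP wx; apply: none; exists w => //; apply/negP => ws.
by apply: (Us w); [rewrite mem_filter wx|exact: subset_closure].
Qed.

(** [O m], for [m] coding [(i, n, k)], consists of the functions exceeding [k]
    somewhere on the [n]-th neighbourhood of [q i], where [q] enumerates an
    open set [U] without isolated points.  A quasicontinuous function in all
    the [O m] is unbounded above on every nonempty open subset of [U], against
    its quasicontinuity at a point of [U]. *)
Lemma dense_isolated_quasicontinuous {R : realType} {X : topologicalType} :
  hausdorff_space X -> first_countable X -> countable [set: X] ->
  completely_metrizable R (set_type (quasicontinuous_functions X R)) ->
  dense (isolated [set: X]).
Proof.
move=> hX /first_countable_base[B hB] cX [d [dm dnbhs dcomplete]] U U0 oU.
apply: contrapT => nUI.
have nI x : U x -> ~ isolated [set: X] x by move=> Ux Ix; apply: nUI; exists x.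
have cU : countable U := sub_countable (subset_card_le (@subsetT _ U)) cX.
have [q Uq] := range_countable U U0 cU.
pose O (m : nat) : set (set_type (quasicontinuous_functions X R)) :=
  if choice.unpickle m is Some (i, n, k) then
    [set f | exists2 w, B (q i) n w & (k : nat)%:R < (val f : X -> R) w]
  else setT.
have interp := quasicontinuous_functions_interpolation hX.
have [f0 _] := interp R [::] (cst 0).
have oO m : open (O m).
  rewrite /O; case: choice.unpickle => [[[i n] k]|]; last exact: openT.
  rewrite openE => f [w Bw kf]; rewrite /interior.
  have /ptws_subtype_cvgP/(_ w) fw : nbhs f --> f by exact: cvg_id.
  by apply: filterS (cvgr_gt _ fw _ kf) => g kg; exists w.
have dO m : dense (O m).
  move=> V [f Vf] oV; rewrite /O.
  case: choice.unpickle => [[[i n] k]|]; last by exists f.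
  have [s [e [e0 hs]]] := nbhs_ptws_subtypeP f V (open_nbhs_nbhs (conj oV Vf)).
  have Uqi : U (q i) by rewrite Uq; exists i.
  have [w Bw ws] := nonisolated_notin (q i) _ s hX (nI _ Uqi) ((hB (q i)).1 n).
  have [g hg] := interp R (w :: s)
    (fun y => if y == w then k.+1%:R else (val f : X -> R) y).
  exists g; split.
    apply: hs => y ys; rewrite hg ?inE ?ys ?orbT//.
    case: eqP => [yw|_]; last by rewrite subrr normr0.
    by rewrite -yw ys in ws.
  by exists w => //; rewrite hg ?inE ?eqxx// ltr_nat.
have [f Of] := metrizable_Baire d O f0 dm dnbhs dcomplete oO dO.
have [x Ux] := U0.
have /set_mem/= qf := valP f.
have oV : open [set r : R | r < (val f : X -> R) x + 1] by exact: open_lt.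
have [W [oW [y Wy] WU fW]] := qf x _ U oV (ltr_pwDr ltr01 (lexx _)) oU Ux.
have : U y by exact: WU.
rewrite Uq => -[i _ qi]; have [n BW] := (hB y).2 W (open_nbhs_nbhs (conj oW Wy)).
have [k hk] : exists k : nat, (val f : X -> R) x + 1 < k%:R.
  exists (Num.bound `|(val f : X -> R) x + 1|).
  exact: le_lt_trans (ler_norm _) (archi_boundP (normr_ge0 _)).
have := Of (choice.pickle (i, n, k)); rewrite /O choice.pickleK qi => -[w Bw].
have /= := fW _ (ex_intro2 _ _ _ (BW _ Bw) erefl).
by move=> h1 /(lt_trans hk)/(lt_trans h1); rewrite ltxx.
Qed.

Theorem theorem3p12 (R : realType) (X : topologicalType)
    (infX : infinite_set [set: X])
    (fcX : first_countable X)
    (hX : hausdorff_space X) :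
  completely_metrizable R (set_type (quasicontinuous_functions X R)) <->
  (countable [set: X] /\ dense (isolated [set: X])).
Proof.
split=> [cmX|[cX dI]].
  have cX : countable [set: X].
    case: (cmX) => d [_ dnbhs _].
    exact: countable_metrizable_quasicontinuous hX dnbhs.
  by split=> //; exact: (@dense_isolated_quasicontinuous R).
exact: completely_metrizable_quasicontinuous (infinite_setN0 infX) fcX cX dI.
Qed.
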